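(* Let $n_1\geqslant n_2\geqslant\cdots\geqslant n_p$ be positive integers with $\sum_{i=1}^p n_i=n$, and let $G=K_{n_1}\cup K_{n_2}\cup\cdots\cup K_{n_p}$ be the graph on $n$ vertices consisting of $p$ complete components $K_{n_1},\dots,K_{n_p}$, so that it has $m=\sum_{i=1}^p\binom{n_i}{2}$ edges. Assume $$n_1-\frac{n_1^2+n_2^2+\cdots+n_p^2}{n}<1.$$ Then $G$ is a Largest Eigenvalue Global Minimizer (LEGM).
   Context: All graphs are simple, undirected and unweighted (no self loops, no multiple edges). The Laplacian of $G$ is $L(G)=D(G)-A(G)$, where $D(G)$ is the diagonal matrix of vertex degrees and $A(G)$ is the adjacency matrix; $\lambda_1(G)$ denotes the largest eigenvalue of $L(G)$. $K_r$ is the complete graph on $r$ vertices and $\cup$ denotes disjoint union of graphs. A graph $G$ with $n$ vertices and $m$ edges is a Largest Eigenvalue Global Minimizer (LEGM) if $\lambda_1(G)\leqslant\lambda_1(H)$ for every simple graph $H$ with $n$ vertices and $m$ edges. *)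

(* Defs.v *)
From HB Require Import structures.
From mathcomp Require Import all_boot all_order all_algebra.
From mathcomp Require Import boolp classical_sets reals.
Set Implicit Arguments.
Unset Strict Implicit.
Unset Printing Implicit Defensive.
Import Order.TTheory GRing.Theory Num.Theory.
Local Open Scope ring_scope.

Record sgraph (V : finType) := SGraph {
  adj :> rel V;
  adj_sym : symmetric adj;
  adj_irrefl : irreflexive adj }.

Definition edges (V : finType) (G : sgraph V) : {set {set V}} :=
  [set [set x; y] | x in V, y in V & G x y].

Definition degree (V : finType) (G : sgraph V) (x : V) : nat :=
  #|[set y | G x y]|.

(* Rows and columns are indexed by V through the enumeration enum_val; the
   spectrum does not depend on the enumeration. *)
Definition adj_matrix (R : realType) (V : finType) (G : sgraph V) :
    'M[R]_#|V| :=
  \matrix_(i, j) (G (enum_val i) (enum_val j))%:R.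

Definition degree_matrix (R : realType) (V : finType) (G : sgraph V) :
    'M[R]_#|V| :=
  diag_mx (\row_i (degree G (enum_val i))%:R).

Definition laplacian (R : realType) (V : finType) (G : sgraph V) :
    'M[R]_#|V| :=
  degree_matrix R G - adj_matrix R G.

(* For nonempty V the supremum is a maximum: see lambda1_max. *)
Definition lambda1 (R : realType) (V : finType) (G : sgraph V) : R :=
  sup [set a : R | eigenvalue (laplacian R G) a]%classic.

Definition LEGM (R : realType) (V : finType) (G : sgraph V) : Prop :=
  forall (W : finType) (H : sgraph W),
    #|W| = #|V| -> #|edges H| = #|edges G| -> lambda1 R G <= lambda1 R H.

Lemma neq_sym (V : eqType) : symmetric (fun x y : V => x != y).
Proof. by move=> x y; rewrite eq_sym. Qed.

Lemma neq_irrefl (V : eqType) : irreflexive (fun x y : V => x != y).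
Proof. by move=> x; rewrite eqxx. Qed.

Definition complete_graph (r : nat) : sgraph 'I_r :=
  SGraph (@neq_sym 'I_r) (@neq_irrefl 'I_r).

Section DisjointUnion.
Variables (I : finType) (V : I -> finType) (G : forall i, sgraph (V i)).

(* When tag u == tag v, tagged_as u v is the second component of v, seen in
   V (tag u). *)
Definition dunion_adj (u v : {i : I & V i}) : bool :=
  (tag u == tag v) && G (tag u) (tagged u) (tagged_as u v).

Lemma dunion_sym : symmetric dunion_adj.
Proof.
move=> [i x] [j y]; rewrite /dunion_adj /= eq_sym.
case: (eqVneq j i) => //= eji; case: _ / eji in x *.
by rewrite !tagged_asE adj_sym.
Qed.

Lemma dunion_irrefl : irreflexive dunion_adj.
Proof. by move=> [i x]; rewrite /dunion_adj eqxx tagged_asE adj_irrefl. Qed.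

Definition dunion : sgraph {i : I & V i} := SGraph dunion_sym dunion_irrefl.

End DisjointUnion.

Section LargestEigenvalue.
Variables (R : realType) (V : finType) (G : sgraph V).

Lemma eigenvalue_laplacian0 : (0 < #|V|)%N -> eigenvalue (laplacian R G) 0.
Proof.
move=> V0; apply/eigenvalueP; exists (const_mx 1); last first.
  apply/eqP => /rowP /(_ (Ordinal V0)); rewrite !mxE.
  by apply/eqP; exact: oner_neq0.
rewrite scale0r; apply/rowP => j; rewrite !mxE.
under eq_bigr => i _ do rewrite !mxE mul1r.
rewrite sumrB (bigD1 j) //= eqxx mulr1n big1 ?addr0; last first.
  by move=> i /negPf ->; rewrite mulr0n.
apply/eqP; rewrite subr_eq0; apply/eqP.
rewrite -natr_sum -(big_enum_val (fun x => nat_of_bool (G x (enum_val j)))) /=.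
rewrite /degree cardsE -sum1_card big_mkcond /=; congr _%:R.
by apply: eq_bigr => x _; rewrite adj_sym -topredE /=; case: (G _ _).
Qed.

Lemma poly_roots_seq (p : {poly R}) : p != 0 ->
  exists rs : seq R, forall a, root p a = (a \in rs).
Proof.
move=> p0.
suff: forall k (rs : seq R), uniq rs -> all (root p) rs ->
    (size p <= size rs + k)%N -> exists rs : seq R, forall a, root p a = (a \in rs).
  by move=> /(_ (size p) [::]); apply.
elim=> [|k IH] rs urs rrs; rewrite ?addn0 ?addnS => sz.
  by have := max_poly_roots p0 rrs urs; rewrite ltnNge sz.
have [[a [ra nars]]|all_rs] := EM (exists a, root p a /\ a \notin rs).
  by apply: (IH (a :: rs)) => /=; rewrite ?nars ?ra ?addSn.
exists rs => a; apply/idP/idP => [ra|]; last exact: (allP rrs).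
by apply/negPn/negP => nars; apply: all_rs; exists a.
Qed.

Lemma lambda1_max : (0 < #|V|)%N ->
  eigenvalue (laplacian R G) (lambda1 R G) /\
  forall a, eigenvalue (laplacian R G) a -> a <= lambda1 R G.
Proof.
move=> /eigenvalue_laplacian0 e0.
have [rs rsP] := poly_roots_seq (monic_neq0 (char_poly_monic (laplacian R G))).
have {}rsP a : eigenvalue (laplacian R G) a = (a \in rs).
  by rewrite eigenvalue_root_char rsP.
have [m mrs ubm] : exists2 m, m \in rs & forall a, a \in rs -> a <= m.
  have: rs != [::] by move: e0; rewrite rsP; case: (rs).
  elim: rs {rsP} => // b [_ _|c rs /(_ isT) [m mrs ubm] _].
    by exists b; [exact: mem_head|move=> a; rewrite inE => /eqP ->].
  have [bm|mb] := leP b m.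
    by exists m => [|a]; rewrite inE ?mrs ?orbT // => /orP[/eqP ->|/ubm].
  exists b => [|a]; first exact: mem_head.
  by rewrite inE => /orP[/eqP ->//|/ubm am]; exact: le_trans am (ltW mb).
suff -> : lambda1 R G = m by split=> [|a]; rewrite rsP //; exact: ubm.
apply/eqP; rewrite eq_le; apply/andP; split.
  by apply: ge_sup => [|a /=]; [exists m; rewrite /= rsP|rewrite rsP; exact: ubm].
by apply: ub_le_sup; [exists m => a /=|rewrite /=]; rewrite rsP //; exact: ubm.
Qed.

End LargestEigenvalue.

(* Main.v *)
(** By the Rayleigh quotient of the vector equal to deg v at v and -1 at the
    neighbours of v, every graph H with a vertex v of positive degree satisfies
    lambda_1(H) >= deg v + 1. The nonzero eigenvalues of G are the n_i > 1. The
    hypothesis says that the average degree 2m/n exceeds n_1 - 2, so any H with n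
    vertices and m edges has a vertex of degree at least n_1 - 1, and then
    lambda_1(H) >= n_1 when n_1 > 1. *)

Require Import Defs.
From HB Require Import structures.
From mathcomp Require Import all_boot all_order all_algebra.
From mathcomp Require Import boolp classical_sets reals.
From mathcomp Require Import complex ring lra.
Set Implicit Arguments.
Unset Strict Implicit.
Unset Printing Implicit Defensive.
Import Order.TTheory GRing.Theory Num.Theory.
Local Open Scope ring_scope.

(** * Rayleigh quotients of real symmetric matrices *)

(* The spectral theorem is available over R[i] only, so A is complexified. *)
Lemma rayleigh_le (R : rcfType) (n : nat) (A : 'M[R]_n) (c : R) (x : 'rV_n) :
  A^T = A -> (forall a, eigenvalue A a -> a <= c) ->
  (x *m A *m x^T) 0 0 <= c * (x *m x^T) 0 0.
Proof.
move=> Asym Ac; pose f : {rmorphism R -> R[i]} := real_complex R.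
pose P := spectralmx (map_mx f A); pose d := spectral_diag (map_mx f A).
have Aherm : map_mx f A \is hermsymmx.
  apply: realsym_hermsym.
    by apply/is_hermitianmxP; rewrite scale1r map_mx_id // map_trmx Asym.
  by apply/mxOverP => i j; rewrite mxE complex_real.
have Au : P \is unitarymx := spectral_unitarymx _.
have Adiag : map_mx f A = invmx P *m diag_mx d *m P.
  exact/orthomx_spectralP/hermitian_normalmx.
(* The diagonal entries are real, and row [i] of [P] is an eigenvector for [d 0 i], so each entry
   comes from an eigenvalue of [A]. *)
have d_le i : d 0 i <= f c.
  have /mxOverP/(_ 0 i)/complex_realP[r dr] :=
    hermitian_spectral_diag_real Aherm.
  rewrite /d dr lecR; apply: Ac; rewrite -(eigenvalue_map f).
  apply/eigenvalueP; exists (row i P).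
    rewrite -row_mul Adiag -mulmxA mulKVmx ?spectral_unit //.
    by rewrite row_mul row_diag_mx -scalemxAl -rowE /d dr.
  apply/eqP => /(congr1 (mulmx^~ (invmx P))).
  rewrite mul0mx -row_mul mulmxV ?spectral_unit // => /rowP/(_ i).
  by rewrite !mxE eqxx => /eqP; rewrite oner_eq0.
(* Coordinates of [x] in the eigenbasis. As [x] is real and [P] unitary, [P *m x^T] is the conjugate
   transpose of [y]. *)
pose y := map_mx f x *m invmx P.
have xT : P *m (map_mx f x)^T = map_mx Num.conj y^T.
  rewrite /y invmx_unitary // trmx_mul map_mxM -map_trmx trmxK -map_mx_comp.
  rewrite (map_mx_id (@conjCK _)); congr (_ *m _).
  by apply/matrixP => i j; rewrite !mxE; apply/esym/CrealP; rewrite complex_real.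
(* Used with [B] equal to [A] and to the identity, which reduces the goal to comparing the sums of
   [d 0 i * |y_i|^2] and [c * |y_i|^2] term by term. *)
have qE B : f ((x *m B *m x^T) 0 0) =
     (y *m (P *m map_mx f B *m invmx P) *m map_mx Num.conj y^T) 0 0.
  rewrite -xT /y !mulmxA !mulmxKV ?spectral_unit // map_trmx -!map_mxM.
  by rewrite [RHS]mxE.
rewrite -lecR -[(c * _)%:C%C]/(f _) (rmorphM f) -[(_ 0 0)%:C%C]/(f _) qE.
have -> : x *m x^T = x *m 1%:M *m x^T by rewrite mulmx1.
rewrite qE map_mx1 mulmx1 mulmxV ?spectral_unit // mulmx1.
rewrite Adiag -(mulmxA _ _ P) mulKVmx ?spectral_unit // mulmxK ?spectral_unit //.
rewrite [leLHS]mxE [(y *m _) 0 0]mxE mulr_sumr ler_sum // => i _.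
rewrite mul_mx_diag !mxE mulrAC mulrC ler_wpM2r //; exact: mul_conjC_ge0.
Qed.

(** * Degrees and the quadratic form of the Laplacian *)

Section GraphLaplacian.
Variables (R : realType) (V : finType) (G : sgraph V).

(** Double counting of the incident pairs (vertex, edge). *)
Lemma sum_degree : (\sum_x degree G x = 2 * #|edges G|)%N.
Proof.
have edgeP e : reflect (exists x y, G x y /\ e = [set x; y]) (e \in edges G).
  apply: (iffP imset2P) => [[x y _]|[x [y [xy ->]]]].
    by rewrite inE => /andP[_ xy] ->; exists x, y.
  by exists x y; rewrite ?inE.
transitivity (\sum_x \sum_(e in edges G) (x \in e))%N.
  apply: eq_bigr => x _; rewrite -big_mkcondr sum1dep_card /degree.
  (* Neighbours [y] of [x] correspond to edges through [x]; injectivity uses that no neighbour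
     equals [x]. *)
  rewrite -(@card_in_imset _ _ (fun y => [set x; y])).
    apply: eq_card => e; rewrite inE; apply/imsetP/andP.
      move=> [y]; rewrite inE => xy ->; rewrite set21.
      by split=> //; apply/edgeP; exists x, y.
    move=> [/edgeP[a [b [ab ->]]]]; rewrite !inE => /orP[]/eqP ->.
      by exists b; rewrite ?inE.
    by exists a; rewrite ?inE 1?adj_sym // finset.setUC.
  move=> y z; rewrite !inE => xy xz /setP/(_ y).
  rewrite !inE eqxx orbT => /esym/orP[/eqP yx|/eqP //].
  by rewrite yx adj_irrefl in xy.
rewrite exchange_big /= mulnC -sum_nat_const; apply: eq_bigr => e.
move=> /edgeP[x [y [xy ->]]]; rewrite -big_mkcond /= sum1_card cards2.
by case: eqP xy => // ->; rewrite adj_irrefl.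
Qed.

Lemma laplacian_tr : (laplacian R G)^T = laplacian R G.
Proof.
by rewrite /laplacian linearB /= tr_diag_mx; congr (_ - _);
   apply/matrixP => i j; rewrite !mxE adj_sym.
Qed.

Lemma natr_degree x : (degree G x)%:R = \sum_y (G x y)%:R :> R.
Proof.
rewrite /degree -sum1_card natr_sum big_mkcond /=; apply: eq_bigr => y _.
by rewrite inE; case: (G x y).
Qed.

Lemma laplacian_mulrE (g : V -> R) j :
  ((\row_i g (enum_val i)) *m laplacian R G) 0 j =
    (degree G (enum_val j))%:R * g (enum_val j)
      - \sum_u (G u (enum_val j))%:R * g u.
Proof.
rewrite /laplacian mulmxBr mxE /degree_matrix mul_mx_diag !mxE mulrC.
congr (_ - _).
rewrite (big_enum_val (fun u => (G u (enum_val j))%:R * g u)) /=.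
by apply: eq_bigr => i _; rewrite !mxE mulrC.
Qed.

(** The sum runs over ordered pairs and meets every edge twice, whence the factor 2. *)
Lemma laplacian_quadratic (g : V -> R) (x := \row_i g (enum_val i)) :
  2 * (x *m laplacian R G *m x^T) 0 0
    = \sum_u \sum_w (G u w)%:R * (g u - g w) ^+ 2.
Proof.
have -> : (x *m laplacian R G *m x^T) 0 0 =
    \sum_w ((degree G w)%:R * g w - \sum_u (G u w)%:R * g u) * g w.
  rewrite mxE [RHS](big_enum_val (fun w => _ * g w)) /=.
  by apply: eq_bigr => j _; rewrite laplacian_mulrE !mxE.
pose D := \sum_u \sum_w (G u w)%:R * g u ^+ 2.
pose B := \sum_u \sum_w (G u w)%:R * (g u * g w).
have -> : \sum_w ((degree G w)%:R * g w - \sum_u (G u w)%:R * g u) * g w = D - B.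
  rewrite /B exchange_big /D -sumrB; apply: eq_bigr => w _ /=.
  rewrite mulrBl natr_degree -mulrA -expr2 !mulr_suml.
  by congr (_ - _); apply: eq_bigr => u _; rewrite mulrA.
have D' : D = \sum_u \sum_w (G u w)%:R * g w ^+ 2.
  rewrite /D exchange_big /=; apply: eq_bigr => u _; apply: eq_bigr => w _.
  by rewrite adj_sym.
transitivity (D - 2 * B + D); first by ring.
rewrite {2}D' /D /B mulr_sumr -sumrB -big_split; apply: eq_bigr => u _ /=.
rewrite mulr_sumr -sumrB -big_split; apply: eq_bigr => w _ /=.
by ring.
Qed.

(* The test vector takes the value deg v at v and -1 at the neighbours of v. *)
Lemma degree_lt_lambda1 v :
  (0 < degree G v)%N -> (degree G v).+1%:R <= lambda1 R G.
Proof.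
move=> d_gt0; set d := degree G v in d_gt0 *.
have V_gt0 : (0 < #|V|)%N by apply/card_gt0P; exists v.
have [_ lmax] := lambda1_max R G V_gt0.
pose g u : R := if u == v then d%:R else - (G v u)%:R.
pose x : 'rV[R]_#|V| := \row_i g (enum_val i).
have := rayleigh_le x laplacian_tr lmax.
have -> : (x *m x^T) 0 0 = d%:R * d.+1%:R.
  rewrite mxE; transitivity (\sum_u g u ^+ 2).
    rewrite (big_enum_val (fun u => g u ^+ 2)) /=.
    by apply: eq_bigr => i _; rewrite !mxE expr2.
  rewrite (bigD1 v) //= /g eqxx -natr1 mulrDr mulr1 -expr2; congr (_ + _).
  rewrite natr_degree [RHS](bigD1 v) //= adj_irrefl add0r.
  apply: eq_bigr => u /negPf ->; rewrite sqrrN.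
  by case: (G v u); rewrite ?expr1n ?expr0n.
(* Only the edges at [v] are kept, each in both orientations: [g] differs by [d + 1] across each of
   these [d] edges, and all other terms are nonnegative. *)
have: 2 * (d%:R * d.+1%:R ^+ 2) <= 2 * (x *m laplacian R G *m x^T) 0 0.
  rewrite laplacian_quadratic (bigD1 v) //= mulr_natl mulr2n.
  have edge_le u w : 0 <= (G u w)%:R * (g u - g w) ^+ 2.
    by rewrite mulr_ge0 ?sqr_ge0.
  have at_v u : (G v u)%:R * (g v - g u) ^+ 2 = (G v u)%:R * d.+1%:R ^+ 2.
    rewrite /g eqxx; case: eqP => [->|_]; first by rewrite adj_irrefl !mul0r.
    by case: (G v u); rewrite ?mul0r // opprK natr1.
  apply: lerD.
    rewrite natr_degree mulr_suml; apply: ler_sum => u _.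
    by rewrite at_v.
  rewrite natr_degree mulr_suml (bigD1 v) //= adj_irrefl mul0r add0r.
  apply: ler_sum => u _; rewrite (bigD1 v) //= -at_v -(opprB (g u)) sqrrN.
  by rewrite adj_sym lerDl sumr_ge0.
have d0 : 0 < d%:R :> R by rewrite ltr0n.
have d1 : 0 < d.+1%:R :> R by rewrite ltr0n.
(* Divide by the squared norm [d * (d + 1)], which is positive because [d] is. *)
move=> lo up; rewrite -(ler_pM2r (mulr_gt0 d0 d1)).
apply: le_trans up; rewrite -(ler_pM2l (ltr0Sn R 1)); apply: le_trans lo.
by rewrite le_eqVlt; apply/orP; left; apply/eqP; ring.
Qed.

Lemma eigenvalue_laplacian a : eigenvalue (laplacian R G) a ->
  exists2 g : V -> R, exists u, g u != 0 &
    forall w, (degree G w)%:R * g w - \sum_u (G u w)%:R * g u = a * g w.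
Proof.
move=> /eigenvalueP[x xL x0]; pose g u := x 0 (enum_rank u).
have xE : x = \row_i g (enum_val i).
  by apply/rowP => i; rewrite mxE /g enum_valK.
exists g.
  move/rV0Pn: x0 => [i xi]; exists (enum_val i).
  by rewrite /g enum_valK.
move=> w; move/rowP/(_ (enum_rank w)): xL.
by rewrite {1}xE laplacian_mulrE enum_rankK mxE.
Qed.

End GraphLaplacian.

(** * The spectrum of a disjoint union of complete graphs *)

Section UnionOfCompleteGraphs.
Variables (p : nat) (ns : 'I_p -> nat).
Let K := dunion (fun i => complete_graph (ns i)).

Lemma dunion_completeE u w : K u w = (tag u == tag w) && (u != w).
Proof.
case: u w => [i x] [j y]; rewrite /= /dunion_adj /=; case: eqVneq => //= eij.
by case: _ / eij in y *; rewrite tagged_asE eq_Tagged.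
Qed.

Lemma card_tag_eq i : #|[pred u : {i : 'I_p & 'I_(ns i)} | tag u == i]| = ns i.
Proof.
rewrite -sum1_card; under eq_bigl => u do rewrite inE -[_ == i]andbT.
rewrite -(sig_big_dep (pred1 i) (fun _ => predT) (fun _ _ => 1%N)) big_pred1_eq.
by rewrite sum1_card card_ord.
Qed.

Lemma degree_dunion_complete w : (degree K w).+1 = ns (tag w).
Proof.
rewrite -card_tag_eq (cardD1 w) inE eqxx add1n /degree; congr _.+1.
apply: eq_card => u.
by rewrite !inE dunion_completeE andbC (eq_sym w) (eq_sym (tag w)).
Qed.

(** In the main proof this becomes [2m + n = \sum_i n_i^2], which links the edge count to the sum of
    squares in the hypothesis. *)
Lemma sum_degree_dunion_complete :
  (\sum_w (degree K w).+1 = \sum_i ns i ^ 2)%N.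
Proof.
under eq_bigr => w _ do rewrite degree_dunion_complete.
rewrite -(sig_big_dep predT (fun _ => predT) (fun i _ => ns i)).
by apply: eq_bigr => i _; rewrite sum_nat_const card_ord mulnn.
Qed.

(* Summing the eigenvalue equation over a component shows that, for a nonzero
   eigenvalue, an eigenvector sums to 0 on each component. *)
Lemma eigenvalue_dunion_complete (R : realType) a :
  eigenvalue (laplacian R K) a ->
  a = 0 \/ exists2 i, (1 < ns i)%N & a = (ns i)%:R.
Proof.
move=> /eigenvalue_laplacian[g [w gw] gL].
have [->|a0] := eqVneq a 0; [by left|right; exists (tag w)].
  (* At an isolated [w] the eigenvalue equation would read [0 = a * g w]. *)
  rewrite -degree_dunion_complete ltnS lt0n; apply/eqP => dw.
  have := gL w; rewrite dw mul0r sub0r => /eqP; rewrite big1 => [|u _].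
    by rewrite oppr0 eq_sym mulf_eq0 (negPf a0) (negPf gw).
  by have := card0_eq dw u; rewrite inE adj_sym => ->; rewrite mul0r.
pose S := \sum_(u | tag u == tag w) g u.
(* A vertex of this component has degree [ns (tag w) - 1], and its neighbours contribute
   [S - g u]. *)
have eqS u : tag u == tag w -> (ns (tag w))%:R * g u - S = a * g u.
  move=> uw; rewrite -gL -(eqP uw) -degree_dunion_complete -natr1 mulrDl mul1r.
  rewrite -addrA; congr (_ + _); rewrite /S (bigD1 u) // opprD addNKr.
  rewrite big_mkcond; congr (- _); apply: eq_bigr => v _.
  by rewrite dunion_completeE (eqP uw); case: (_ && _); rewrite ?mul1r ?mul0r.
have S0 : S = 0.
  have: \sum_(u | tag u == tag w) ((ns (tag w))%:R * g u - S) = a * S.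
    by rewrite mulr_sumr; apply: eq_bigr => u; exact: eqS.
  rewrite sumrB -mulr_sumr sumr_const card_tag_eq mulr_natl subrr.
  by move/esym/eqP; rewrite mulf_eq0 (negPf a0) => /eqP.
by move: (eqS w (eqxx _)); rewrite S0 subr0 => /(mulIf gw).
Qed.

End UnionOfCompleteGraphs.

Theorem theorem4p2 (R : realType) (n p : nat) (p_gt0 : (0 < p)%N)
    (ns : 'I_p -> nat)
    (ns_gt0 : forall i : 'I_p, (0 < ns i)%N)
    (ns_noninc : forall i j : 'I_p, (i <= j)%N -> (ns j <= ns i)%N)
    (ns_sum : (\sum_(i < p) ns i)%N = n)
    (ns_cond : (ns (Ordinal p_gt0))%:R
                 - (\sum_(i < p) (ns i)%:R ^+ 2) / n%:R < 1 :> R) :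
  LEGM R (dunion (fun i : 'I_p => complete_graph (ns i))).
Proof.
set K := dunion _; pose n1 := ns (Ordinal p_gt0).
have n1_max i : (ns i <= n1)%N by exact: ns_noninc.
have n_gt0 : (0 < n)%N.
  by rewrite -ns_sum (bigD1 (Ordinal p_gt0)) //= addn_gt0 ns_gt0.
have cardK : #|{: {i : 'I_p & 'I_(ns i)}}| = n.
  rewrite -ns_sum -sum1_card -(sig_big_dep predT (fun _ => predT) (fun _ _ => 1%N)).
  by apply: eq_bigr => i _; rewrite sum1_card card_ord.
move=> W H cardW edgesH; rewrite cardK in cardW.
have [lK _] := lambda1_max R K (etrans (congr1 (leq 1) cardK) n_gt0).
have [_ lH] := lambda1_max R H (etrans (congr1 (leq 1) cardW) n_gt0).
(* If the largest eigenvalue of [K] is 0, it suffices that 0 is an eigenvalue for [H] too. *)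
have [->|[i ni_gt1 ->]] := eigenvalue_dunion_complete lK.
  by apply/lH/eigenvalue_laplacian0; rewrite cardW.
have [v dv] : exists v, (n1 <= (degree H v).+1)%N.
  (* Otherwise every degree is at most [n1 - 2]. Summing gives [2m + 2n <= n * n1], that is
     [\sum_i n_i^2 + n <= n * n1], against the hypothesis multiplied by [n]. *)
  apply/not_existsP => small.
  have: (\sum_(v : W) (degree H v).+2 <= \sum_(v : W) n1)%N.
    by apply: leq_sum => v _; rewrite ltnNge; apply/negP/small.
  under eq_bigr => v _ do rewrite -addn2.
  rewrite big_split /= !sum_nat_const cardW sum_degree edgesH -sum_degree.
  have := sum_degree_dunion_complete ns.
  under eq_bigr => u _ do rewrite -addn1.
  rewrite big_split /= sum_nat_const cardK muln1 => sumK le_sum.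
  have {sumK} le_sq : (\sum_(j < p) ns j ^ 2 + n <= n * n1)%N.
    by rewrite -sumK -addnA addnn -muln2.
  have n0 : 0 < n%:R :> R by rewrite ltr0n.
  move: ns_cond; rewrite -(ltr_pM2r n0) mulrBl divfK ?gt_eqF // mul1r.
  move: le_sq; rewrite -(ler_nat R) natrD natrM natr_sum.
  under eq_bigr => j _ do rewrite natrX.
  by rewrite -/n1; lra.
apply: (@le_trans _ _ (degree H v).+1%:R).
  by rewrite ler_nat; exact: leq_trans dv.
(* The degree is positive since [1 < ns i <= n1 <= degree H v + 1]. *)
apply: degree_lt_lambda1; rewrite -ltnS.
exact: leq_trans ni_gt1 (leq_trans (n1_max i) dv).
Qed.
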